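(* Let $p$ be a prime and let $\|\cdot\|_p$ be the $p$-adic norm on $\mathbb{Q}$. Then $\operatorname{asdim}(\mathbb{Q},\|\cdot\|_p)=0$, i.e. the metric space $(\mathbb{Q},d_p)$ with $d_p(x,y)=\|x-y\|_p$ has asymptotic dimension $0$.
   Context: The $p$-adic norm is given by $\|0\|_p=0$ and, for nonzero integers $m=p^a m'$ and $n=p^b n'$ with $p$ dividing neither $m'$ nor $n'$, $\|m/n\|_p=p^{b-a}$. Asymptotic dimension of a metric space: a family $\mathcal{U}$ of subsets of a metric space $(X,d)$ is $R$-bounded if $\sup\{\operatorname{diam} U \mid U\in\mathcal{U}\}\le R$, and it is $D$-disjoint if $d(x,y)>D$ whenever $x\in U$, $y\in V$, $U,V\in\mathcal{U}$ and $U\ne V$. One says $\operatorname{asdim} X\le n$ if for every $D>0$ there are a number $R$ and $n+1$ families $\mathcal{U}_0,\dots,\mathcal{U}_n$ of subsets of $X$, each $D$-disjoint and $R$-bounded, such that $\bigcup_i\mathcal{U}_i$ is a cover of $X$; $\operatorname{asdim} X$ is the least such $n$. The metric $d_p$ on $\mathbb{Q}$ is not proper; the asymptotic dimension here is that of the metric space $(\mathbb{Q},d_p)$. *)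

(* Defs.v *)
From HB Require Import structures.
From mathcomp Require Import all_boot all_order all_algebra.
From mathcomp Require Import all_classical all_reals all_analysis.
From mathcomp Require Import ring lra zify.

Set Implicit Arguments.
Unset Strict Implicit.
Unset Printing Implicit Defensive.

Import Order.TTheory GRing.Theory Num.Theory.
Local Open Scope classical_set_scope.
Local Open Scope ring_scope.

Section AsymptoticDimension.
Context {R : realType} (X : metricType R).
Implicit Types (U V : set X) (F : set (set X)).

(* The element 0 only matters for U = set0: it makes diam set0 = 0 instead of
   ereal_sup set0 = -oo. *)
Definition diam U : \bar R :=
  ereal_sup (0%E |` [set (mdist z.1 z.2)%:E | z in U `*` U]).

Definition bounded_family (r : R) F : Prop :=
  (ereal_sup [set diam U | U in F] <= r%:E)%E.

Definition disjoint_family (D : R) F : Prop :=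
  forall U V, F U -> F V -> U <> V ->
  forall x y, U x -> V y -> D < mdist x y.

Definition asdim_le (n : nat) : Prop :=
  forall D : R, 0 < D ->
  exists (r : R) (F : 'I_n.+1 -> set (set X)),
    (forall i, disjoint_family D (F i) /\ bounded_family r (F i)) /\
    \bigcup_(U in \bigcup_i F i) U = [set: X].

(* "asdim X = n"; a relation, since no such n need exist. *)
Definition is_asdim (n : nat) : Prop :=
  asdim_le n /\ forall m, asdim_le m -> (n <= m)%N.

End AsymptoticDimension.

Section PadicNorm.
Context {R : realType}.
Implicit Types (p : nat) (x y : rat) (m n : int).

(* Read off the reduced fraction; padic_norm_frac shows that any other
   representation of x as a quotient of integers gives the same value. *)
Definition padic_norm p x : R :=
  if x == 0 then 0
  else p%:R ^ ((logn p `|denq x|%N)%:Z - (logn p `|numq x|%N)%:Z).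

Lemma padic_norm_logn p m n : m != 0 -> n != 0 ->
  padic_norm p (m%:Q / n%:Q) =
  p%:R ^ ((logn p `|n|%N)%:Z - (logn p `|m|%N)%:Z).
Proof.
move=> m0 n0; set x := m%:Q / n%:Q.
have x0 : x != 0 by rewrite mulf_neq0 ?invr_eq0 ?intr_eq0.
rewrite /padic_norm (negPf x0); congr (_ ^ _).
have e : m * denq x = numq x * n.
  apply: (@intr_inj rat); rewrite !rmorphM /=.
  have dx : (denq x)%:Q != 0 by rewrite intr_eq0 denq_neq0.
  have nx : n%:Q != 0 by rewrite intr_eq0.
  have : m%:Q / n%:Q = (numq x)%:Q / (denq x)%:Q by rewrite divq_num_den.
  by move/eqP; rewrite eqr_div// => /eqP.
move: (congr1 (fun k : int => logn p `|k|%N) e).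
rewrite !abszM !lognM ?absz_gt0 ?denq_neq0 ?numq_eq0//.
lia.
Qed.

Lemma padic_norm_frac p (a b : nat) (m' n' : int) : prime p ->
  ~~ (p%:Z %| m')%Z -> ~~ (p%:Z %| n')%Z ->
  padic_norm p ((p%:Z ^+ a * m')%:Q / (p%:Z ^+ b * n')%:Q) =
  p%:R ^ (b%:Z - a%:Z).
Proof.
move=> pp pm pn.
have p0 : p%:Z != 0 by move: (prime_gt0 pp); lia.
have m0 : m' != 0 by apply: contraNneq pm => ->; rewrite dvdz0.
have n0 : n' != 0 by apply: contraNneq pn => ->; rewrite dvdz0.
have lE k (c : int) : c != 0 -> ~~ (p%:Z %| c)%Z ->
    logn p `|(p%:Z ^+ k * c)%R|%N = k.
  move=> c0 pc; rewrite abszM abszX absz_nat lognM ?absz_gt0 ?expn_gt0 ?prime_gt0//.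
  by rewrite pfactorK// logn_coprime ?addn0// prime_coprime.
by rewrite padic_norm_logn ?mulf_neq0 ?expf_neq0// !lE.
Qed.

Lemma padic_norm_ge0 p x : 0 <= padic_norm p x.
Proof. by rewrite /padic_norm; case: ifP => // _; rewrite exprz_ge0. Qed.

Lemma padic_norm0 p : padic_norm p 0 = 0.
Proof. by rewrite /padic_norm eqxx. Qed.

Lemma padic_norm_eq0 p x : prime p -> padic_norm p x = 0 -> x = 0.
Proof.
move=> pp; rewrite /padic_norm; case: ifP => [/eqP //|_ /eqP].
by rewrite expfz_eq0 pnatr_eq0 -leqn0 leqNgt prime_gt0// andbF.
Qed.

Lemma padic_normN p x : padic_norm p (- x) = padic_norm p x.
Proof. by rewrite /padic_norm oppr_eq0 denqN numqN abszN. Qed.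

Lemma padic_norm_ultra p x y : prime p ->
  padic_norm p (x + y) <= Num.max (padic_norm p x) (padic_norm p y).
Proof.
move=> pp.
have [->|x0] := eqVneq x 0; first by rewrite add0r le_max lexx orbT.
have [->|y0] := eqVneq y 0; first by rewrite addr0 le_max lexx.
have [->|xy0] := eqVneq (x + y) 0.
  by rewrite padic_norm0 le_max padic_norm_ge0.
pose d := denq x * denq y; pose a := numq x * denq y; pose b := numq y * denq x.
have dx : (denq x)%:Q != 0 by rewrite intr_eq0 denq_neq0.
have dy : (denq y)%:Q != 0 by rewrite intr_eq0 denq_neq0.
have d0 : d != 0 by rewrite mulf_neq0 ?denq_neq0.
have xE : x = a%:Q / d%:Q.
  by rewrite -[LHS]divq_num_den /a /d !rmorphM /=; field; rewrite dx dy.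
have yE : y = b%:Q / d%:Q.
  by rewrite -[LHS]divq_num_den /b /d !rmorphM /=; field; rewrite dx dy.
have xyE : x + y = (a + b)%:Q / d%:Q by rewrite xE yE -mulrDl rmorphD.
have nz (c : int) z : z != 0 -> z = c%:Q / d%:Q -> c != 0.
  by move=> z0 zE; apply: contra_neq z0 => c0; rewrite zE c0 mul0r.
have a0 := nz _ _ x0 xE; have b0 := nz _ _ y0 yE; have ab0 := nz _ _ xy0 xyE.
rewrite xyE xE yE !padic_norm_logn//.
have p1 : 1 <= p%:R :> R by rewrite ler1n prime_gt0.
have key : (minn (logn p `|a|) (logn p `|b|) <= logn p `|(a + b)%R|)%N.
  rewrite -pfactor_dvdn ?absz_gt0//.
  have /= dvda : (Posz (p ^ minn (logn p `|a|) (logn p `|b|)) %| a)%Z.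
    by rewrite dvdzE absz_nat pfactor_dvdn ?absz_gt0// geq_minl.
  have /= dvdb : (Posz (p ^ minn (logn p `|a|) (logn p `|b|)) %| b)%Z.
    by rewrite dvdzE absz_nat pfactor_dvdn ?absz_gt0// geq_minr.
  by have := rpredD dvda dvdb; rewrite dvdzE absz_nat.
rewrite le_max; apply/orP.
case: (leqP (logn p `|a|) (logn p `|b|)) key => ab key; [left|right];
  apply: ler_weXz2l => //; lia.
Qed.

Lemma padic_normD p x y : prime p ->
  padic_norm p (x + y) <= padic_norm p x + padic_norm p y.
Proof.
move=> pp; apply: le_trans (padic_norm_ultra x y pp) _.
by rewrite ge_max lerDl lerDr !padic_norm_ge0.
Qed.

End PadicNorm.

(* A copy of rat carrying the p-adic metric; the primality proof is an argument
   of the type because the metric axioms depend on it. *)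
Definition padic_rat (R : realType) (p : nat) (p_pr : prime p) : Type := rat.

Section PadicMetric.
Context (R : realType) (p : nat) (p_pr : prime p).
Local Notation Q := (padic_rat R p_pr).

Definition padic_dist (x y : Q) : R := padic_norm p ((x : rat) - (y : rat)).

Let padic_distxx x : padic_dist x x = 0.
Proof. by rewrite /padic_dist subrr padic_norm0. Qed.

Let padic_dist_positivity x y : padic_dist x y = 0 -> x = y.
Proof. by move=> /(padic_norm_eq0 p_pr)/eqP; rewrite subr_eq0 => /eqP. Qed.

Let padic_dist_sym x y : padic_dist x y = padic_dist y x.
Proof. by rewrite /padic_dist -padic_normN opprB. Qed.

Let padic_dist_triangle y x z :
  padic_dist x z <= padic_dist x y + padic_dist y z.
Proof.
rewrite /padic_dist -[(x : rat) - z](@subrKA rat y).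
exact: padic_normD.
Qed.

HB.instance Definition _ := Choice.copy Q rat.
HB.instance Definition _ := isMetric.Build R Q
  padic_distxx padic_dist_positivity padic_dist_sym padic_dist_triangle.

Lemma mdist_padic (x y : Q) :
  mdist x y = padic_norm p ((x : rat) - (y : rat)).
Proof. by []. Qed.

End PadicMetric.

(* Main.v *)
Require Import Defs.
From mathcomp Require Import all_boot all_order all_algebra.
From mathcomp Require Import all_classical all_reals all_analysis.

(** The p-adic distance satisfies the strong triangle inequality
    d x z <= max (d x y) (d y z), and every metric space with this property has
    asymptotic dimension 0: for each D > 0 the relation d x y <= D is transitive
    ([mdist_le_trans]), hence an equivalence relation, and its classes are the
    closed balls of radius D.  These balls cover the space, have diameter at
    most D, and two points at distance at most D lie in the same ball, so the
    single family of all of them is D-disjoint ([ultrametric_asdim_le]).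
    Minimality of 0 is automatic, since dimensions are natural numbers. *)

Import Order.TTheory GRing.Theory Num.Theory.
Local Open Scope classical_set_scope.
Local Open Scope ring_scope.

Definition ultrametric {R : realType} (X : metricType R) : Prop :=
  forall x y z : X, mdist x z <= Num.max (mdist x y) (mdist y z).

(** Not the closure of the open ball: in an ultrametric space open balls are
    already closed, so that closure misses the points at distance exactly D. *)
Definition cball {R : realType} {X : metricType R} (D : R) (x : X) : set X :=
  [set y | mdist x y <= D].

Section Ultrametric.
Context {R : realType} (X : metricType R) (X_ultra : ultrametric X).

Lemma mdist_le_trans {D : R} (y x z : X) :
  mdist x y <= D -> mdist y z <= D -> mdist x z <= D.
Proof.
by move=> xy yz; apply: le_trans (X_ultra x y z) _; rewrite ge_max xy yz.
Qed.

(** By transitivity of the relation d x y <= D, a ball is the whole class of each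
    of its points; so distinct balls cannot have points at distance at most D. *)
Lemma cball_center (D : R) (x y : X) : mdist x y <= D -> cball D x = cball D y.
Proof.
move=> xy; apply/seteqP; split => z /=; apply: mdist_le_trans => //.
by rewrite metric_sym.
Qed.

Lemma diam_cball (D : R) (x : X) : 0 <= D -> (diam (cball D x) <= D%:E)%E.
Proof.
move=> D0; apply: ge_ereal_sup => _ [->|[[y z] [/= xy xz] <-]].
  by rewrite lee_fin.
by rewrite lee_fin; apply: mdist_le_trans xz; rewrite metric_sym.
Qed.

Lemma ultrametric_asdim_le : asdim_le X 0.
Proof.
move=> D D0; exists D, (fun=> range (cball D)); split=> [_|].
  split=> [_ _ [a _ <-] [b _ <-] ab x y ax yb|].
    rewrite ltNge; apply/negP => xy; apply: ab.
    by rewrite (cball_center _ _ _ ax) (cball_center _ _ _ xy)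
               (cball_center _ _ _ yb).
  by apply: ge_ereal_sup => _ [_ [x _ <-] <-]; apply: diam_cball; apply: ltW.
apply/seteqP; split=> // x _; exists (cball D x).
  by exists ord0 => //; exists x.
by rewrite /cball /= mdistxx ltW.
Qed.

End Ultrametric.

Lemma padic_ultrametric (R : realType) (p : nat) (p_pr : prime p) :
  ultrametric (padic_rat R p_pr).
Proof.
move=> x y z; rewrite !mdist_padic -[(x : rat) - z](@subrKA rat y).
exact: padic_norm_ultra.
Qed.

Theorem theorem5 (R : realType) (p : nat) (p_pr : prime p) :
  is_asdim (padic_rat R p_pr) 0%N.
Proof.
by split=> //; apply: ultrametric_asdim_le; apply: padic_ultrametric.
Qed.
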